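(* There is an absolute constant $C>0$ such that the following holds. Let $k\ge 2$ be an even integer and let $Q$ be a permutation matrix contained in $X_k$. Then \[ c_Q \le 2^{C\log^2 k}. \]
   Context: For an even integer $k\ge 2$, $X_k$ is the $k\times k$ binary matrix with $1$-entries exactly at the positions $(i,j)$, $i,j\in[k]$, with $i=j$ or $i+j=k+1$. A binary matrix $A$ contains a binary matrix $B$ if $B$ can be obtained from $A$ by deleting some rows, some columns, and changing some $1$-entries to $0$-entries; otherwise $A$ avoids $B$. A permutation matrix is a square binary matrix with exactly one $1$-entry in each row and each column. $\mathrm{ex}(n,B)$ is the maximum number of $1$-entries in an $n\times n$ binary matrix avoiding $B$. For a permutation matrix $P$, $c_P=\lim_{n\to\infty}\mathrm{ex}(n,P)/n$ (this limit exists and is finite). Logarithms are base $2$. *)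

(* Defs.v *)
From HB Require Import structures.
From mathcomp Require Import all_boot all_order all_algebra.
From mathcomp Require Import all_classical all_reals all_analysis.

Set Implicit Arguments.
Unset Strict Implicit.
Unset Printing Implicit Defensive.

Import Order.TTheory GRing.Theory Num.Theory.
Import numFieldNormedType.Exports.

Local Open Scope ring_scope.

(* Binary matrices are matrices over bool, [true] being a 1-entry. *)

(* The strictly increasing maps f and g select the rows and columns of A that
   are kept; the implication accounts for the 1-entries changed to 0. *)
Definition contains (m n p q : nat) (A : 'M[bool]_(m, n))
    (B : 'M[bool]_(p, q)) : bool :=
  [exists f : {ffun 'I_p -> 'I_m}, exists g : {ffun 'I_q -> 'I_n},
    [&& [forall i : 'I_p, forall i' : 'I_p, (i < i')%N ==> (f i < f i')%N],
        [forall j : 'I_q, forall j' : 'I_q, (j < j')%N ==> (g j < g j')%N]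
      & [forall i, forall j, B i j ==> mxsub f g A i j]]].

Definition avoids (m n p q : nat) (A : 'M[bool]_(m, n))
    (B : 'M[bool]_(p, q)) : bool := ~~ contains A B.

Definition permutation_matrix (m : nat) (P : 'M[bool]_m) : bool :=
  [forall i, #|[pred j | P i j]| == 1%N] &&
  [forall j, #|[pred i | P i j]| == 1%N].

(* The entry of 0-based index (i, j) is at the 1-based position
   (i.+1, j.+1). *)
Definition Xmx (k : nat) : 'M[bool]_k :=
  \matrix_(i < k, j < k) ((i == j) || (i.+1 + j.+1 == k.+1)%N).

Definition nb_ones (m n : nat) (A : 'M[bool]_(m, n)) : nat :=
  #|[pred ij : 'I_m * 'I_n | A ij.1 ij.2]|.

(* Every matrix contains the empty pattern, for which this is 0; a pattern with
   a 1-entry is avoided by the zero matrix, so the maximum is then over a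
   nonempty set. *)
Definition ex (n p q : nat) (B : 'M[bool]_(p, q)) : nat :=
  \max_(A : 'M[bool]_n | avoids A B) nb_ones A.

Definition ex_ratio (R : realType) (m : nat) (P : 'M[bool]_m) : R^nat :=
  fun n => (ex n P)%:R / n%:R.

Definition FH_limit (R : realType) (m : nat) (P : 'M[bool]_m) : R :=
  limn (ex_ratio R P).

Definition log2 (R : realType) (x : R) : R := ln x / ln 2.

(* Main.v *)
Require Import Defs.
From HB Require Import structures.
From mathcomp Require Import all_boot all_order all_algebra.
From mathcomp Require Import all_classical all_reals all_analysis.
From mathcomp Require Import zify ring lra.
Import Order.TTheory GRing.Theory Num.Theory.
Import numFieldNormedType.Exports.

(** Marcus-Tardos: cut A into S x S blocks with S = 4 s^2 and 4 k <= s <= 8 k.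
    Blocks meeting fewer than s rows and s columns hold fewer than s^2 ones, and there
    are at most ex(n / S) nonempty blocks, so all reduces to bounding by
    N = k^O(log k) the number of blocks with at least s nonempty columns in one
    column of blocks. View such a block as a set of at least s of the S columns.
    Given N = (2k)^D of them, D = O(log k), some run of consecutive blocks splits
    into 2k equal parts, each of whose unions contains 31/32 of the union W of
    the run: otherwise one could pass to a part with a smaller union D times,
    until it has fewer than s elements. Merging the blocks of each part gives a
    (2k) x |W| matrix of density 31/32. As the four entries of a layer of the X
    shape can be displaced horizontally without affecting the other layers, an
    averaging argument yields k/2 complete layers, that is X_k, after merging
    rows; a permutation survives the merging.

    The limit exists by Fekete's lemma. The outermost entry of Q is a corner, so
    placing two Q-avoiding matrices along the diagonal or antidiagonal that does
    not go through this corner avoids Q, and ex is superadditive. *)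

Set Implicit Arguments.
Unset Strict Implicit.
Unset Printing Implicit Defensive.

Local Open Scope nat_scope.

(** * Merging consecutive rows, viewed as sets of columns *)

(** [u i] stands for the set of nonempty columns in row [i], so that the union is the row obtained
    by merging rows [x] to [x + L - 1]. *)
Definition row_union (T : finType) (u : nat -> {set T}) (x L : nat) : {set T} :=
  \bigcup_(x <= i < x + L) u i.

Lemma row_unionS (T : finType) (u : nat -> {set T}) x L :
  row_union u x L.+1 = row_union u x L :|: u (x + L).
Proof. by rewrite /row_union addnS big_nat_recr // leq_addr. Qed.

Lemma row_unionP (T : finType) (u : nat -> {set T}) x L y :
  reflect (exists2 i, x <= i < x + L & y \in u i) (y \in row_union u x L).
Proof.
apply: (iffP idP) => [|[i]].
  elim: L => [|L IH]; first by rewrite /row_union addn0 big_geq // inE.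
  rewrite row_unionS inE => /orP[/IH[i i_in yi]|yu].
    by exists i => //; lia.
  by exists (x + L) => //; lia.
elim: L => [|L IH] i_in yi; first by lia.
rewrite row_unionS inE; have [i_eq|i_neq] := eqVneq i (x + L).
  by rewrite -i_eq yi orbT.
by rewrite IH //; lia.
Qed.

Lemma row_union_sub (T : finType) (u : nat -> {set T}) x L x' L' :
  x' <= x -> x + L <= x' + L' -> row_union u x L \subset row_union u x' L'.
Proof.
move=> le_x le_L; apply/fintype.subsetP => y /row_unionP[i i_in yi].
by apply/row_unionP; exists i => //; lia.
Qed.

(* If the r parts do not all carry most of the union, descend into one that does
   not: its union is smaller by the factor p / p.+1, which can happen fewer than
   D times before the union gets smaller than a single row. *)
Lemma exists_rich_parts (T : finType) (u : nat -> {set T}) p r s D x :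
    0 < p -> 0 < r ->
    (forall i, x <= i < x + r ^ D -> s <= #|u i|) ->
    p ^ D * #|row_union u x (r ^ D)| < p.+1 ^ D * s ->
  exists y L, [/\ 0 < L, x <= y, y + r * L <= x + r ^ D &
    forall j, j < r ->
      p * #|row_union u y (r * L)| <= p.+1 * #|row_union u (y + j * L) L|].
Proof.
move=> p_gt0 r_gt0; elim: D x => [|D IH] x u_ge.
  rewrite !expn0 !mul1n row_unionS /row_union addn0 big_geq // finset.set0U.
  by rewrite ltnNge u_ge //; lia.
move=> U_lt.
have [all_rich|] := boolP [forall j : 'I_r,
    p * #|row_union u x (r * r ^ D)| <= p.+1 * #|row_union u (x + j * r ^ D) (r ^ D)|].
  exists x, (r ^ D); split=> //; first by rewrite expn_gt0 r_gt0.
    by rewrite expnS.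
  by move=> j j_lt; have /forallP/(_ (Ordinal j_lt)) := all_rich.
rewrite negb_forall => /existsP[j]; rewrite -ltnNge => poor.
have le_part : j * r ^ D + r ^ D <= r ^ D.+1.
  by rewrite -mulSnr expnS leq_mul2r ltn_ord orbT.
have [i i_in||y [L [L_gt0 le_y le_L rich]]] := IH (x + j * r ^ D).
- by apply: u_ge; lia.
- rewrite -(ltn_pmul2l (ltn0Sn p)) [ltnRHS]mulnA -expnS.
  apply: leq_ltn_trans U_lt; rewrite !expnS mulnCA [p * _]mulnC -mulnA.
  by rewrite leq_mul2l (ltnW poor) orbT.
by exists y, L; split=> //; lia.
Qed.

(** * Finding X_k in a dense matrix *)

(** As the shift [t] varies, an entry of a layer runs through distinct columns of its row, so it is
    missing for no more shifts than the row has missing columns. *)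
Lemma count_shift (h : pred nat) T w (phi : nat -> nat) :
    {in gtn T &, injective phi} -> (forall t, t < T -> phi t < w) ->
  count (h \o phi) (iota 0 T) <= count h (iota 0 w).
Proof.
move=> phi_inj phi_lt; rewrite -count_map -!size_filter; apply: uniq_leq_size.
  rewrite filter_uniq // map_inj_in_uniq ?iota_uniq // => i j.
  by rewrite !mem_iota => i_in j_in; apply: phi_inj; rewrite inE; lia.
move=> y; rewrite !mem_filter => /andP[-> /mapP[t]].
by rewrite !mem_iota => t_in ->; rewrite add0n phi_lt //; lia.
Qed.

Lemma count_or_le (I : eqType) (a b c : pred I) (s : seq I) :
  {in s, forall x, a x -> b x || c x} -> count a s <= count b s + count c s.
Proof.
move=> abc; rewrite -count_predUI; apply: leq_trans (leq_addr _ _).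
elim: s abc => //= x s IH abc; apply: leq_add.
  by have := abc x (mem_head _ _); case: (a x) => //= /(_ isT) ->.
by apply: IH => y ys; apply: abc; rewrite inE ys orbT.
Qed.

Lemma sum_count_exchange (a : nat -> nat -> bool) m n :
  \sum_(i <- iota 0 m) count (a i) (iota 0 n) =
  \sum_(j <- iota 0 n) count (a^~ j) (iota 0 m).
Proof.
under eq_bigr do rewrite -sum1_count big_mkcond.
under [in RHS]eq_bigr do rewrite -sum1_count big_mkcond.
exact: exchange_big.
Qed.

(* The four entries of the i-th outermost layer, displaced t columns inwards. *)
Definition layer_full (k w : nat) (D : nat -> nat -> bool) (t i : nat) : bool :=
  [&& D i (t + i), D i (w.-1 - (t + i)), D ((2 * k).-1 - i) (t + i)
    & D ((2 * k).-1 - i) (w.-1 - (t + i))].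

(* Averaging over t: a random shift makes a layer incomplete with probability at
   most 4 * (1/32) / (1/4) = 1/2. *)
Lemma exists_shift k w (D : nat -> nat -> bool) :
    ~~ odd k -> 0 < k -> 4 * k <= w ->
    (forall i, i < 2 * k -> 32 * count (fun c => ~~ D i c) (iota 0 w) <= w) ->
  exists2 t, t + k <= w./2 &
    k./2 <= count (layer_full k w D t) (iota 0 k).
Proof.
(* Shifts below w/4 keep [t + i] in the left half, because k <= w/4. *)
move=> k_even k_gt0 le_kw D_dense; pose T := w %/ 4.
pose bad t i := ~~ layer_full k w D t i.
have row_bad i : i < k -> 8 * count (bad^~ i) (iota 0 T) <= w.
  move=> i_lt.
  pose h1 t := ~~ D i (t + i); pose h2 t := ~~ D i (w.-1 - (t + i)).
  pose h3 t := ~~ D ((2 * k).-1 - i) (t + i).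
  pose h4 t := ~~ D ((2 * k).-1 - i) (w.-1 - (t + i)).
  have c1 : count h1 (iota 0 T) <= count (fun c => ~~ D i c) (iota 0 w).
    apply: (@count_shift (fun c => ~~ D i c) T w (addn^~ i)) => [a b _ _|t]; lia.
  have c3 : count h3 (iota 0 T) <=
      count (fun c => ~~ D ((2 * k).-1 - i) c) (iota 0 w).
    apply: (@count_shift (fun c => ~~ D ((2 * k).-1 - i) c) T w (addn^~ i));
      [move=> a b _ _|move=> t]; lia.
  have c2 : count h2 (iota 0 T) <= count (fun c => ~~ D i c) (iota 0 w).
    apply: (@count_shift (fun c => ~~ D i c) T w (fun t => w.-1 - (t + i)));
      [move=> a b|move=> t]; rewrite ?inE; lia.
  have c4 : count h4 (iota 0 T) <=
      count (fun c => ~~ D ((2 * k).-1 - i) c) (iota 0 w).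
    apply: (@count_shift (fun c => ~~ D ((2 * k).-1 - i) c) T w
      (fun t => w.-1 - (t + i))); [move=> a b|move=> t]; rewrite ?inE; lia.
  have d1 : 32 * count (fun c => ~~ D i c) (iota 0 w) <= w.
    by apply: D_dense; lia.
  have d2 : 32 * count (fun c => ~~ D ((2 * k).-1 - i) c) (iota 0 w) <= w.
    by apply: D_dense; lia.
  pose h34 t := h3 t || h4 t; pose h234 t := h2 t || h34 t.
  have e1 : count (bad^~ i) (iota 0 T) <=
      count h1 (iota 0 T) + count h234 (iota 0 T).
    by apply: count_or_le => t _; rewrite /bad /layer_full !negb_and.
  have e2 : count h234 (iota 0 T) <= count h2 (iota 0 T) + count h34 (iota 0 T).
    by apply: count_or_le.
  have e3 : count h34 (iota 0 T) <= count h3 (iota 0 T) + count h4 (iota 0 T).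
    by apply: count_or_le.
  move: (count (bad^~ i) _) c1 c2 c3 c4 d1 d2 e1 e2 e3 => cb.
  by clearbody h1 h2 h3 h4 h34 h234 T; lia.
have [t t_lt t_good] : exists2 t, t < T & count (bad t) (iota 0 k) <= k./2.
  have [/existsP[t t_good]|] :=
      boolP [exists t : 'I_T, count (bad t) (iota 0 k) <= k./2].
    by exists t.
  rewrite negb_exists => /forallP all_bad.
  (* Double counting of the pairs of a shift and a layer incomplete for it: at least T(k/2 + 1) if
     every shift is bad, against at most kw/8. The extra 1 pays for the rounding in [T]. *)
  have low : T * (k./2).+1 <= \sum_(t <- iota 0 T) count (bad t) (iota 0 k).
    have -> : T * (k./2).+1 = \sum_(t <- iota 0 T) (k./2).+1.
      by rewrite big_const_seq count_predT size_iota iter_addn_0 mulnC.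
    rewrite big_seq [leqRHS]big_seq; apply: leq_sum => t.
    rewrite mem_iota add0n => /andP[_ t_lt].
    by have := all_bad (Ordinal t_lt); rewrite -ltnNge.
  have high : 8 * \sum_(t <- iota 0 T) count (bad t) (iota 0 k) <= w * k.
    rewrite sum_count_exchange big_distrr /=.
    have -> : w * k = \sum_(i <- iota 0 k) w.
      by rewrite big_const_seq count_predT size_iota iter_addn_0.
    rewrite big_seq [leqRHS]big_seq; apply: leq_sum => i.
    by rewrite mem_iota add0n => /andP[_ i_lt]; apply: row_bad.
  have : 8 * (T * (k./2).+1) <= w * k by lia.
  have w_le : w <= 4 * T + 3 by rewrite /T; lia.
  have -> : k = 2 * k./2 by lia.
  by move: (k./2) => a in k_gt0 le_kw *; nia.
exists t; first by rewrite /T in t_lt; lia.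
have := count_predC (layer_full k w D t) (iota 0 k).
rewrite size_iota -[count (predC _) _]/(count (bad t) (iota 0 k)); lia.
Qed.

(** Complete layers under a common shift are nested, so k/2 of them form X_k. [g] lists them from
    the outside in; the first half of the rows and of the columns follows [g], the second half its
    mirror image. *)
Lemma X_in_dense k w (D : nat -> nat -> bool) :
    ~~ odd k -> 0 < k -> 4 * k <= w ->
    (forall i, i < 2 * k -> 32 * count (fun c => ~~ D i c) (iota 0 w) <= w) ->
  exists F G : nat -> nat,
   [/\ forall i j, i < j < k -> F i < F j,
       forall i j, i < j < k -> G i < G j,
       forall i, i < k -> F i < 2 * k,
       forall i, i < k -> G i < w &
       forall i j, i < k -> j < k -> (i == j) || (i.+1 + j.+1 == k.+1) ->
         D (F i) (G j)].
Proof.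
move=> k_even k_gt0 le_kw D_dense.
have [t t_lt t_good] := exists_shift k_even k_gt0 le_kw D_dense.
pose good := [seq i <- iota 0 k | layer_full k w D t i].
pose g i := nth 0 good i.
have size_good : k./2 <= size good by rewrite size_filter.
have g_in i : i < k./2 -> (g i < k) && layer_full k w D t (g i).
  move=> i_lt; have : g i \in good by rewrite mem_nth // (leq_trans i_lt).
  by rewrite mem_filter mem_iota => /and3P[-> _ ->].
have g_lt i : i < k./2 -> g i < k by move/g_in/andP => [].
have g_mono i j : i < j < k./2 -> g i < g j.
  move=> ij; apply: (sorted_ltn_nth ltn_trans); rewrite ?inE;
    [|by apply: leq_trans size_good; lia..|lia].
  by rewrite sorted_filter ?iota_ltn_sorted //; exact: ltn_trans.
exists (fun i => if i < k./2 then g i else (2 * k).-1 - g (k.-1 - i)).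
exists (fun j => if j < k./2 then t + g j else w.-1 - (t + g (k.-1 - j))).
split=> [i j ij|i j ij|i i_lt|i i_lt|i j i_lt j_lt].
- case: ifP => ih; case: ifP => jh; first by apply: g_mono; lia.
  + by have := g_lt i ih; have := g_lt (k.-1 - j); lia.
  + by lia.
  + by have := g_mono (k.-1 - j) (k.-1 - i); have := g_lt (k.-1 - i); lia.
- case: ifP => ih; case: ifP => jh; first by rewrite ltn_add2l g_mono //; lia.
  + by have := g_lt i ih; have := g_lt (k.-1 - j); lia.
  + by lia.
  + by have := g_mono (k.-1 - j) (k.-1 - i); have := g_lt (k.-1 - i); lia.
- by case: ifP => ih; [have := g_lt i ih|]; lia.
- by case: ifP => ih; [have := g_lt i ih|]; lia.
move=> X_ij; case: ifP => ih; case: ifP => jh.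
- have -> : j = i by lia.
  by have /andP[_ /and4P[]] := g_in i ih.
- have -> : k.-1 - j = i by lia.
  by have /andP[_ /and4P[]] := g_in i ih.
- have -> : k.-1 - i = j by lia.
  by have /andP[_ /and4P[]] := g_in j jh.
- have -> : k.-1 - j = k.-1 - i by lia.
  have i'_lt : k.-1 - i < k./2 by lia.
  by have /andP[_ /and4P[]] := g_in _ i'_lt.
Qed.

(** * Criteria for containment *)

Lemma containsP m n p q (A : 'M[bool]_(m, n)) (B : 'M[bool]_(p, q)) :
  reflect (exists (f : 'I_p -> 'I_m) (g : 'I_q -> 'I_n),
     [/\ forall i i' : 'I_p, i < i' -> f i < f i',
         forall j j' : 'I_q, j < j' -> g j < g j' &
         forall i j, B i j -> A (f i) (g j)])
    (contains A B).
Proof.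
apply: (iffP existsP) => [[f /existsP[g /and3P[fP gP AB]]]|[f [g [fP gP AB]]]].
  exists f, g; split=> [i i'|j j'|i j Bij].
  - by move: fP => /forallP/(_ i)/forallP/(_ i')/implyP.
  - by move: gP => /forallP/(_ j)/forallP/(_ j')/implyP.
  - by move: AB => /forallP/(_ i)/forallP/(_ j)/implyP/(_ Bij); rewrite mxE.
exists [ffun i => f i]; apply/existsP; exists [ffun j => g j].
apply/and3P; split; apply/forallP => i; apply/forallP => j; apply/implyP.
- by rewrite !ffunE; apply: fP.
- by rewrite !ffunE; apply: gP.
- by rewrite mxE !ffunE; apply: AB.
Qed.

Lemma permutation_matrixP m (Q : 'M[bool]_m) : permutation_matrix Q ->
  exists s t : 'I_m -> 'I_m,
    (forall i j, Q i j = (j == s i)) /\ (forall i j, Q i j = (i == t j)).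
Proof.
move=> /andP[/forallP rowQ /forallP colQ].
have /choice[s sP] : forall i, exists k, forall j, Q i j = (j == k).
  move=> i; have /card1P[j Qij] := rowQ i.
  by exists j => j'; have := Qij j'; rewrite !inE.
have /choice[t tP] : forall j, exists k, forall i, Q i j = (i == k).
  move=> j; have /card1P[i Qij] := colQ j.
  by exists i => i'; have := Qij i'; rewrite !inE.
by exists s, t; split=> // i j.
Qed.

(* Each row of Q only needs a row of A for its single 1-entry, and likewise for
   columns, so it suffices to find the 1-entries of Q one by one, in the right
   relative order. *)
Lemma contains_permutation m n1 n2 (A : 'M[bool]_(n1, n2)) (Q : 'M[bool]_m)
    (row_ok : 'I_n1 -> 'I_m -> Prop) (col_ok : 'I_n2 -> 'I_m -> Prop) :
    permutation_matrix Q ->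
    (forall (i i' : 'I_m) (x x' : 'I_n1),
       i < i' -> row_ok x i -> row_ok x' i' -> x < x') ->
    (forall (j j' : 'I_m) (y y' : 'I_n2),
       j < j' -> col_ok y j -> col_ok y' j' -> y < y') ->
    (forall i j, Q i j -> exists x y, [/\ A x y, row_ok x i & col_ok y j]) ->
  contains A Q.
Proof.
move=> /permutation_matrixP[s [t [sP tP]]] row_mono col_mono QA.
have /choice[w wP] : forall i, exists xy : 'I_n1 * 'I_n2,
    [/\ A xy.1 xy.2, row_ok xy.1 i & col_ok xy.2 (s i)].
  move=> i; have [|x [y xyP]] := QA i (s i); first by rewrite sP.
  by exists (x, y).
have st j : s (t j) = j by apply/esym/eqP; rewrite -sP tP.
apply/containsP; exists (fun i => (w i).1), (fun j => (w (t j)).2); split.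
- move=> i i' lt_i; have [_ r _] := wP i; have [_ r' _] := wP i'.
  exact: row_mono r r'.
- move=> j j' lt_j; have [_ _] := wP (t j); have [_ _] := wP (t j').
  by rewrite !st => c' c; apply: col_mono c c'.
- by move=> i j; rewrite tP => /eqP ->; have [] := wP (t j).
Qed.

(** * Transposition, reflection and the corners of Q *)

Lemma contains_tr m n p q (A : 'M[bool]_(m, n)) (B : 'M[bool]_(p, q)) :
  contains A^T B^T = contains A B.
Proof.
apply/containsP/containsP => -[f [g [fP gP AB]]]; exists g, f; split=> // i j.
  by have := AB j i; rewrite !mxE.
by rewrite !mxE; apply: AB.
Qed.

Definition flip m n (A : 'M[bool]_(m, n)) : 'M[bool]_(m, n) :=
  \matrix_(i, j) A i (rev_ord j).

Lemma flipK m n : involutive (@flip m n).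
Proof. by move=> A; apply/matrixP => i j; rewrite !mxE rev_ordK. Qed.

Lemma contains_flip m n p q (A : 'M[bool]_(m, n)) (B : 'M[bool]_(p, q)) :
  contains (flip A) (flip B) = contains A B.
Proof.
have dir (A' : 'M[bool]_(m, n)) (B' : 'M[bool]_(p, q)) :
    contains A' B' -> contains (flip A') (flip B').
  move=> /containsP[f [g [fP gP AB]]]; apply/containsP.
  exists f, (fun j => rev_ord (g (rev_ord j))); split=> // [j j' lt_j|i j].
    have := gP (rev_ord j') (rev_ord j); have := ltn_ord (g (rev_ord j)).
    by have := ltn_ord j'; rewrite /=; lia.
  by rewrite !mxE rev_ordK; apply: AB.
by apply/idP/idP => [/dir|]; [rewrite !flipK|exact: dir].
Qed.

Lemma permutation_matrix_tr m (Q : 'M[bool]_m) :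
  permutation_matrix Q -> permutation_matrix Q^T.
Proof.
move=> /andP[/forallP rowQ /forallP colQ]; apply/andP; split; apply/forallP => i.
  by rewrite -(eqP (colQ i)); apply/eqP; apply: eq_card => j; rewrite !inE mxE.
by rewrite -(eqP (rowQ i)); apply/eqP; apply: eq_card => j; rewrite !inE mxE.
Qed.

Lemma permutation_matrix_flip m (Q : 'M[bool]_m) :
  permutation_matrix Q -> permutation_matrix (flip Q).
Proof.
move=> /andP[/forallP rowQ /forallP colQ]; apply/andP; split; apply/forallP => i.
  rewrite -(eqP (rowQ i)) -!sum1_card [X in _ == X](reindex_inj rev_ord_inj).
  by apply/eqP; apply: eq_bigl => j; rewrite !inE mxE.
rewrite -(eqP (colQ (rev_ord i))).
by apply/eqP; apply: eq_card => j; rewrite !inE mxE.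
Qed.

Lemma nb_onesE m n (A : 'M[bool]_(m, n)) :
  nb_ones A = \sum_i \sum_j (A i j : nat).
Proof.
rewrite pair_bigA /nb_ones -sum1_card big_mkcond /=.
by apply: eq_bigr => ij _; rewrite !inE; case: (A _ _).
Qed.

Lemma nb_ones_tr m n (A : 'M[bool]_(m, n)) : nb_ones A^T = nb_ones A.
Proof.
rewrite !nb_onesE exchange_big /=.
by apply: eq_bigr => i _; apply: eq_bigr => j _; rewrite mxE.
Qed.

Lemma nb_ones_flip m n (A : 'M[bool]_(m, n)) : nb_ones (flip A) = nb_ones A.
Proof.
rewrite !nb_onesE; apply: eq_bigr => i _; rewrite [RHS](reindex_inj rev_ord_inj).
by apply: eq_bigr => j _; rewrite mxE.
Qed.

Lemma nb_ones_le_ex m n (Q : 'M[bool]_m) (A : 'M[bool]_n) :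
  ~~ contains A Q -> nb_ones A <= ex n Q.
Proof. by move=> A_Q; apply: leq_bigmax_cond. Qed.

Lemma ex_leP m n (Q : 'M[bool]_m) b :
  reflect (forall A : 'M[bool]_n, ~~ contains A Q -> nb_ones A <= b)
          (ex n Q <= b).
Proof. exact: bigmax_leqP. Qed.

Lemma ex_tr m n (Q : 'M[bool]_m) : ex n Q^T = ex n Q.
Proof.
have le Q' : ex n (Q' : 'M[bool]_m) <= ex n Q'^T.
  apply/ex_leP => A A_Q; rewrite -nb_ones_tr nb_ones_le_ex //.
  by rewrite contains_tr.
by apply/eqP; rewrite eqn_leq le -{2}[Q]trmxK le.
Qed.

Lemma ex_flip m n (Q : 'M[bool]_m) : ex n (flip Q) = ex n Q.
Proof.
have le Q' : ex n (Q' : 'M[bool]_m) <= ex n (flip Q').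
  apply/ex_leP => A A_Q; rewrite -nb_ones_flip nb_ones_le_ex //.
  by rewrite contains_flip.
by apply/eqP; rewrite eqn_leq le -{2}[Q]flipK le.
Qed.

Lemma Xmx_tr k : (Xmx k)^T%R = Xmx k.
Proof.
by apply/matrixP => i j; rewrite !mxE eq_sym [_ + _]addnC.
Qed.

(* A row or column of Q on the outermost layer of X_k among those used has its
   1-entry at an end. *)
Lemma corner_of_contained_X k m (Q : 'M[bool]_m.+1) :
    permutation_matrix Q -> contains (Xmx k) Q ->
  [|| Q ord0 ord0, Q ord0 ord_max, Q ord_max ord0 | Q ord_max ord_max].
Proof.
move=> /permutation_matrixP[s [t [sP tP]]] /containsP[f [g [fP gP QX]]].
(* [e] is the index of a layer counted from the outside; a 1-entry of X_k joins a row and a column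
   of the same layer. *)
pose e (x : 'I_k) := minn x (k.-1 - x).
have eQ i j : Q i j -> e (f i) = e (g j).
  move=> /QX; rewrite mxE => /orP[/eqP->//|].
  by have := ltn_ord (f i); have := ltn_ord (g j); rewrite /e; lia.
have fle (i i' : 'I_m.+1) : i <= i' -> f i <= f i'.
  by rewrite leq_eqVlt => /orP[/eqP/val_inj->//|/fP/ltnW].
have outer i0 : (forall i, e (f i0) <= e (f i)) -> Q i0 ord0 || Q i0 ord_max.
  move=> e_min; pose j := s i0.
  have Qj : Q i0 j by rewrite sP.
  have e0 : e (f i0) <= e (g ord0).
    by rewrite -(eQ (t ord0)) // tP.
  have e1 : e (f i0) <= e (g ord_max).
    by rewrite -(eQ (t ord_max)) // tP.
  have ej := eQ _ _ Qj.
  have [j0|j_gt0] := posnP j.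
    by have -> : ord0 = j; [exact: val_inj|rewrite Qj].
  have [jm|j_ltm] := eqVneq j ord_max; first by rewrite -jm Qj orbT.
  (* [e] strictly increases up to the middle and strictly decreases after it, so an inner column
     would leave the first or the last one with a smaller value. *)
  have l0 := gP ord0 j j_gt0.
  have l1 : g j < g ord_max.
    by apply: gP; have := leq_ord j; move: j_ltm; rewrite -val_eqE /=; lia.
  by move: e0 e1; rewrite ej /e; have := ltn_ord (g ord_max); lia.
have bounds i : minn (e (f ord0)) (e (f ord_max)) <= e (f i).
  have := fle ord0 i (leq0n _); have := fle i ord_max (leq_ord i).
  by rewrite /e; have := ltn_ord (f ord_max); lia.
have [le|lt] := leqP (e (f ord0)) (e (f ord_max)).
  have /orP[->|->] : Q ord0 ord0 || Q ord0 ord_max.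
  - by apply: outer => i; have := bounds i; lia.
  - by [].
  - by rewrite orbT.
have /orP[->|->] : Q ord_max ord0 || Q ord_max ord_max.
- by apply: outer => i; have := bounds i; lia.
- by rewrite !orbT.
- by rewrite !orbT.
Qed.

(** * Blocks with many nonempty columns *)

(** Columns keep their index in [A], so the blocks of one column of blocks are subsets of a common
    set of at most [S] columns. Applied to the transpose, this gives the nonempty rows of a
    block. *)
Definition block_cols n1 n2 (S : nat) (A : 'M[bool]_(n1, n2)) (a b : nat) :
    {set 'I_n2} :=
  [set y : 'I_n2 | (y %/ S == b) && [exists x : 'I_n1, (x %/ S == a) && A x y]].

Lemma card_block S n b : 0 < S -> #|[set y : 'I_n | y %/ S == b]| <= S.
Proof.
move=> S_gt0; rewrite cardE -(size_map val) -[leqRHS](size_iota (b * S)).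
apply: uniq_leq_size => [|_ /mapP[y yb ->]].
  by rewrite map_inj_uniq ?enum_uniq //; exact: val_inj.
move: yb; rewrite mem_enum inE mem_iota => /eqP <-.
by rewrite leq_trunc_div -mulSnr ltn_ceil.
Qed.

Lemma sorted_enum_set n (W : {set 'I_n}) :
  sorted ltn [seq val y | y <- enum W].
Proof.
rewrite /enum_mem -enumT; apply: (@subseq_sorted _ _ ltn_trans _ (iota 0 n)).
  by rewrite -val_enum_ord map_subseq // filter_subseq.
exact: iota_ltn_sorted.
Qed.

Lemma count_enum_set (T : finType) (V W : {set T}) : V \subset W ->
  count (fun y => y \notin V) (enum W) = #|W| - #|V|.
Proof.
move=> VW; have := count_predC (mem V) (enum W); rewrite -cardE.
suff -> : count (mem V) (enum W) = #|V| by move=> <-; rewrite addKn.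
rewrite -size_filter cardE; apply/perm_size/uniq_perm; rewrite ?enum_uniq //.
  by rewrite filter_uniq ?enum_uniq.
move=> y; rewrite mem_filter !mem_enum andbC.
by apply: andb_idl => /(fintype.subsetP VW).
Qed.

(** With (2k)^D wide blocks, some run of them splits into 2k rich parts. X_k is found in the matrix
    of parts against columns, and its entries used by Q are traced back to 1-entries of [A]. The
    inequality between [S] and [s] is what rules out [D] descents. *)
Lemma wide_blocks_lt m n1 n2 k S s D M b
    (A : 'M[bool]_(n1, n2)) (Q : 'M[bool]_m) :
    permutation_matrix Q -> contains (Xmx k) Q -> ~~ odd k -> 0 < k ->
    4 * k <= s -> 0 < S -> 31 ^ D * S < 32 ^ D * s -> ~~ contains A Q ->
  count (fun a => s <= #|block_cols S A a b|) (iota 0 M) < (2 * k) ^ D.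
Proof.
move=> permQ /containsP[f [g [fP gP QX]]] k_even k_gt0 le_ks S_gt0 S_lt.
apply: contraNltn => many.
pose wide a := s <= #|block_cols S A a b|.
pose rs := [seq a <- iota 0 M | wide a].
have rs_mono z z' : z < z' < (2 * k) ^ D -> nth 0 rs z < nth 0 rs z'.
  move=> zz; have z'_lt : z' < size rs.
    by rewrite size_filter; apply: leq_trans many; lia.
  apply: (sorted_ltn_nth ltn_trans); rewrite ?inE //; [|lia..].
  by rewrite sorted_filter ?iota_ltn_sorted //; exact: ltn_trans.
pose u z := block_cols S A (nth 0 rs z) b.
have u_ge z : z < (2 * k) ^ D -> s <= #|u z|.
  move=> z_lt; have : nth 0 rs z \in rs.
    by rewrite mem_nth // size_filter (leq_trans z_lt).
  by rewrite mem_filter => /andP[].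
have U_sub L : row_union u 0 L \subset [set y : 'I_n2 | y %/ S == b].
  by apply/fintype.subsetP => y /row_unionP[z _]; rewrite !inE => /andP[].
have [||z||y0 [L [L_gt0 _ le_L rich]]] :=
  @exists_rich_parts _ u 31 (2 * k) s D 0; rewrite ?muln_gt0 //.
- by rewrite add0n => /u_ge.
- apply: leq_ltn_trans S_lt; rewrite leq_mul2l expn_eq0 /=.
  by rewrite (leq_trans (subset_leq_card (U_sub _))) // card_block.
rewrite add0n in le_L.
set W := row_union u y0 (2 * k * L) in rich.
have part_sub i : i < 2 * k -> row_union u (y0 + i * L) L \subset W.
  move=> i_lt; apply: row_union_sub; first exact: leq_addr.
  by rewrite -addnA -mulSnr leq_add2l leq_mul2r i_lt orbT.
have W_gt0 : 0 < 2 * k * L by rewrite !muln_gt0 k_gt0.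
have W_ge : s <= #|W|.
  have /u_ge/leq_trans : y0 < (2 * k) ^ D by lia.
  apply; apply/subset_leq_card/fintype.subsetP => y yu.
  by apply/row_unionP; exists y0 => //; lia.
have /card_gt0P[yd _] : 0 < #|W| by lia.
pose col c := nth yd (enum W) c.
have col_mono c c' : c < c' < #|W| -> col c < col c'.
  move=> cc'; have c'_lt : c' < size (enum W) by rewrite -cardE; lia.
  have c_lt : c < size (enum W) by lia.
  rewrite -!(nth_map yd 0 val) //.
  by apply: (sorted_ltn_nth ltn_trans);
    rewrite ?sorted_enum_set ?inE ?size_map //; lia.
(* The columns of the dense matrix are the elements of [W] in increasing order; the ratio 31/32 of
   the rich parts leaves at most 1/32 of them missing in each row. *)
have [|i i_lt|F [G [F_mono G_mono F_lt G_lt FG]]] :=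
  @X_in_dense k #|W| (fun i c => col c \in row_union u (y0 + i * L) L)
    k_even k_gt0.
- exact: leq_trans W_ge.
- rewrite -(count_map col (fun y => y \notin row_union u (y0 + i * L) L)).
  have -> : [seq col c | c <- iota 0 #|W|] = enum W.
    by rewrite cardE -[RHS](mkseq_nth yd).
  rewrite count_enum_set ?part_sub //.
  have := rich i i_lt; have := subset_leq_card (part_sub i i_lt); lia.
(* A row may come from any of the blocks merged into the part chosen for [i], since the parts alone
   decide the order; columns are prescribed exactly. *)
pose row_ok (x : 'I_n1) i := exists z, [/\ z < (2 * k) ^ D,
  y0 + F (f i) * L <= z < y0 + F (f i) * L + L & x %/ S = nth 0 rs z].
pose col_ok (y : 'I_n2) j := y = col (G (g j)).
apply: (@contains_permutation _ _ _ A Q row_ok col_ok permQ).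
- move=> i i' x x' /fP lt_f [z [z_lt z_in xz]] [z' [z'_lt z'_in xz']].
  have lt_F : F (f i) < F (f i') by apply: F_mono; rewrite lt_f ltn_ord.
  have le_F : F (f i) * L + L <= F (f i') * L by rewrite -mulSnr leq_mul2r lt_F orbT.
  have lt_z : z < z' by lia.
  have := rs_mono z z'; rewrite lt_z z'_lt -xz -xz' => /(_ isT).
  by apply: contraTltn => /(leq_div2r S); rewrite -leqNgt.
- move=> j j' y y' /gP lt_g -> ->; apply: col_mono.
  by rewrite G_mono ?G_lt ?lt_g /=.
move=> i j /QX; rewrite mxE => /FG.
rewrite !ltn_ord => /(_ isT isT)/row_unionP[z z_in].
rewrite inE => /andP[_ /existsP[x /andP[/eqP xz Axy]]].
exists x, (col (G (g j))); split=> //; exists z; split=> //.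
apply: leq_trans le_L; case/andP: z_in => _ /leq_trans; apply.
by rewrite -addnA leq_add2l -mulSnr leq_mul2r F_lt ?ltn_ord ?orbT.
Qed.

(** * The Marcus-Tardos recursion *)

Definition contract_blocks n (S M : nat) (A : 'M[bool]_n) : 'M[bool]_M :=
  \matrix_(a, b) [exists x : 'I_n, exists y : 'I_n,
    [&& x %/ S == a, y %/ S == b & A x y]].

(** A 1-entry of the contraction can be replaced by any 1-entry of [A] in its block: those of a
    permutation lie in distinct rows and columns of blocks, which fixes their order. *)
Lemma contract_avoids m n S M (A : 'M[bool]_n) (Q : 'M[bool]_m) :
  permutation_matrix Q -> ~~ contains A Q -> ~~ contains (contract_blocks S M A) Q.
Proof.
move=> permQ; apply: contraNN => /containsP[f [g [fP gP QA]]].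
have div_lt x x' : x %/ S < x' %/ S -> x < x'.
  by apply: contraTltn => /(leq_div2r S); rewrite -leqNgt.
apply: (@contains_permutation _ _ _ A Q (fun x i => x %/ S = f i)
  (fun y j => y %/ S = g j) permQ).
- by move=> i i' x x' /fP lt_f xi xi'; apply: div_lt; rewrite xi xi'.
- by move=> j j' y y' /gP lt_g yj yj'; apply: div_lt; rewrite yj yj'.
move=> i j /QA; rewrite mxE => /existsP[x /existsP[y /and3P[/eqP xi /eqP yj Axy]]].
by exists x, y.
Qed.

(** The 1-entries of a block lie in the product of its nonempty rows and its nonempty columns. *)
Lemma nb_ones_blocks n S M (A : 'M[bool]_n) : (n %/ S < M)%N ->
  nb_ones A <=
    \sum_(a < M) \sum_(b < M) #|block_cols S A a b| * #|block_cols S A^T b a|.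
Proof.
case: M => // M lt_M; have div_lt (x : 'I_n) : x %/ S < M.+1.
  by apply: leq_ltn_trans lt_M; rewrite leq_div2r // ltnW.
rewrite pair_bigA /nb_ones -sum1_card.
pose blk (p : 'I_n * 'I_n) : 'I_M.+1 * 'I_M.+1 :=
  (inord (p.1 %/ S), inord (p.2 %/ S)).
rewrite (partition_big blk xpredT) //=; apply: leq_sum => -[a b] _ /=.
rewrite sum1_card mulnC -cardsX; apply: subset_leq_card.
apply/fintype.subsetP => -[x y]; rewrite !inE /= => /andP[Axy /eqP[xa yb]].
have {}xa : x %/ S = a by rewrite -xa inordK.
have {}yb : y %/ S = b by rewrite -yb inordK.
rewrite xa yb !eqxx /=; apply/andP; split; apply/existsP.
  by exists y; rewrite yb mxE eqxx.
by exists x; rewrite xa eqxx.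
Qed.

Lemma sum_bool_count M (p : pred nat) :
  \sum_(a < M) (p a : nat) = count p (iota 0 M).
Proof.
rewrite -(big_mkord xpredT (fun a => p a : nat)) -sum1_count [RHS]big_mkcond /=.
by rewrite /index_iota subn0; apply: eq_bigr => a _; case: (p a).
Qed.

(** Wide and tall blocks number at most [M * N] each and hold at most S^2 ones; any other nonempty
    block holds at most s^2 and is a 1-entry of the contraction. *)
Lemma ex_recursion m n k S s D (Q : 'M[bool]_m) :
    permutation_matrix Q -> contains (Xmx k) Q -> ~~ odd k -> 0 < k ->
    4 * k <= s -> 0 < S -> 31 ^ D * S < 32 ^ D * s ->
  ex n Q <= s ^ 2 * ex (n %/ S).+1 Q
            + 2 * (n %/ S).+1 * (2 * k) ^ D * S ^ 2.
Proof.
move=> permQ XQ k_even k_gt0 le_ks S_gt0 S_lt; apply/ex_leP => A A_Q.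
set M := (n %/ S).+1; set N := (2 * k) ^ D.
pose c a b := #|block_cols S A a b|; pose r a b := #|block_cols S A^T b a|.
have c_le a b : c a b <= S.
  rewrite (leq_trans _ (@card_block S n b S_gt0)) // subset_leq_card //.
  by apply/fintype.subsetP => y; rewrite !inE => /andP[].
have r_le a b : r a b <= S.
  rewrite (leq_trans _ (@card_block S n a S_gt0)) // subset_leq_card //.
  by apply/fintype.subsetP => y; rewrite !inE => /andP[].
have wide_le : \sum_(a < M) \sum_(b < M) (s <= c a b : nat) <= M * N.
  rewrite exchange_big /= -[M in M * N](card_ord M) -sum_nat_const.
  apply: leq_sum => b _; rewrite (sum_bool_count _ (fun a => s <= c a b)).
  exact/ltnW/(wide_blocks_lt M b permQ XQ).
have tall_le : \sum_(a < M) \sum_(b < M) (s <= r a b : nat) <= M * N.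
  rewrite -[M in M * N](card_ord M) -sum_nat_const.
  apply: leq_sum => a _; rewrite (sum_bool_count _ (fun b => s <= r a b)).
  (* Tall blocks of [A] are wide blocks of its transpose, and X_k is symmetric. *)
  apply/ltnW/(@wide_blocks_lt _ _ _ k _ _ _ _ _ _ Q^T%R) => //.
  - exact: permutation_matrix_tr.
  - by rewrite -Xmx_tr contains_tr.
  - by rewrite contains_tr.
have few : \sum_(a < M) \sum_(b < M) (contract_blocks S M A a b : nat) <= ex M Q.
  by rewrite -nb_onesE nb_ones_le_ex // contract_avoids.
apply: leq_trans (nb_ones_blocks A (ltnSn (n %/ S))) _.
have block_le (a b : 'I_M) : c a b * r a b <=
    s ^ 2 * contract_blocks S M A a b + S ^ 2 * (s <= c a b) + S ^ 2 * (s <= r a b).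
  have cr_le : c a b * r a b <= S ^ 2 by rewrite leq_mul.
  case: (leqP s (c a b)) => c_s; first by rewrite muln1 -addnA addnCA (leq_trans cr_le) ?leq_addr.
  case: (leqP s (r a b)) => r_s; first by rewrite muln1 addnC (leq_trans cr_le) ?leq_addr.
  rewrite !muln0 !addn0; case: (boolP (contract_blocks S M A a b)) => A_ab.
    by rewrite muln1 leq_mul // ltnW.
  rewrite muln0 leqn0 muln_eq0; apply/orP; left; apply: contraR A_ab.
  rewrite -lt0n => /card_gt0P[y]; rewrite inE => /andP[yb /existsP[x /andP[xa Axy]]].
  by rewrite mxE; apply/existsP; exists x; apply/existsP; exists y; rewrite xa yb.
apply: leq_trans (_ : \sum_(a < M) \sum_(b < M)
    (s ^ 2 * contract_blocks S M A a b + S ^ 2 * (s <= c a b)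
     + S ^ 2 * (s <= r a b)) <= _).
  by apply: leq_sum => a _; apply: leq_sum => b _; exact: block_le.
under eq_bigr do rewrite !big_split -!big_distrr /=.
rewrite !big_split -!big_distrr /= -addnA leq_add //.
  by rewrite leq_mul2l few orbT.
rewrite -mulnDr mulnC leq_mul2r mul2n -addnn mulnDl leq_add ?orbT //.
Qed.

Lemma ex_le_sqr m n (Q : 'M[bool]_m) : ex n Q <= n ^ 2.
Proof.
apply/ex_leP => A _; rewrite /nb_ones (leq_trans (max_card _)) //.
by rewrite card_prod card_ord.
Qed.

Lemma ex_linear m n k s D (Q : 'M[bool]_m) :
    permutation_matrix Q -> contains (Xmx k) Q -> ~~ odd k -> 0 < k ->
    4 * k <= s -> 31 ^ D * (4 * s) < 32 ^ D ->
  ex n Q <= 32 * (2 * k) ^ D * s ^ 2 * n.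
Proof.
move=> permQ XQ k_even k_gt0 le_ks s_lt.
(* Once n >= S, (n/S + 1) S <= 2n, so [S = 4 s^2] keeps the recursive term below half of [B * n];
   [B] is chosen so that the other term fits into the second half. *)
set N := (2 * k) ^ D; set B := 32 * N * s ^ 2; pose S := 4 * s ^ 2.
have N_gt0 : 0 < N by rewrite expn_gt0 muln_gt0 k_gt0.
have s_gt1 : 1 < s by lia.
have S_gt0 : 0 < S by rewrite muln_gt0 expn_gt0; lia.
have S_gt1 : 4 < S by rewrite /S expnS expn1; nia.
have S_lt : 31 ^ D * S < 32 ^ D * s.
  by rewrite /S expnS expn1 !mulnA ltn_mul2r -mulnA s_lt andbT; lia.
have SB : S <= B by rewrite /S /B; nia.
elim/ltn_ind: n => n IH.
have [le_nB|lt_Bn] := leqP n B.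
  by rewrite (leq_trans (ex_le_sqr n Q)) // expnS expn1 leq_mul2r le_nB orbT.
apply: leq_trans (ex_recursion n permQ XQ k_even k_gt0 le_ks S_gt0 S_lt) _.
rewrite -/N; set q := n %/ S.
have q_gt0 : 0 < q by rewrite divn_gt0 //; lia.
have qS : q * S <= n by rewrite leq_trunc_div.
have q_lt : q.+1 < n by nia.
have {}IH := IH _ q_lt.
rewrite -(leq_pmul2l S_gt0).
have -> : S * (B * n) = s ^ 2 * B * (4 * n) by rewrite /S; lia.
have q_le : q.+1 * S <= 2 * n by nia.
have h1 : S * (s ^ 2 * ex q.+1 Q) <= s ^ 2 * B * (2 * n).
  apply: leq_trans (_ : S * (s ^ 2 * (B * q.+1)) <= _).
    by rewrite !leq_mul2l IH !orbT.
  have -> : S * (s ^ 2 * (B * q.+1)) = s ^ 2 * B * (q.+1 * S) by lia.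
  by rewrite leq_mul2l q_le orbT.
have h2 : S * (2 * q.+1 * N * S ^ 2) <= s ^ 2 * B * (2 * n).
  have -> : S * (2 * q.+1 * N * S ^ 2) = s ^ 2 * B * (q.+1 * S).
    by rewrite /B /S; ring.
  by rewrite leq_mul2l q_le orbT.
by rewrite mulnDr; lia.
Qed.

(** * Superadditivity of [ex] *)

(** In a block diagonal matrix, the top right entry of a copy of Q falls into one block. If it is
    the upper one, no column of the copy lies further right; if it is the lower one, no row lies
    further up. Either way the whole copy is in that block. *)
Lemma ex_superadditive_top_right m a b (Q : 'M[bool]_m.+1) :
    permutation_matrix Q -> Q ord0 ord_max ->
  ex a Q + ex b Q <= ex (a + b) Q.
Proof.
move=> permQ corner.
have max_ex c : exists2 A : 'M[bool]_c, ~~ contains A Q & ex c Q = nb_ones A.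
  have [|A A_Q maxA] := @eq_bigmax_cond _ [pred A : 'M[bool]_c | ~~ contains A Q]
    (@nb_ones c c); last by exists A; rewrite // -maxA; apply: eq_bigl.
  (* The zero matrix avoids Q, which has a 1-entry, so the maximum is attained. *)
  apply/card_gt0P; exists (const_mx false); rewrite unfold_in.
  by apply/containsP => -[f [g [_ _ /(_ _ _ corner)]]]; rewrite mxE.
have [A A_Q ->] := max_ex a; have [B B_Q ->] := max_ex b.
pose AB := block_mx A (const_mx false) (const_mx false) B.
have -> : nb_ones A + nb_ones B = nb_ones AB.
  rewrite !nb_onesE big_split_ord /=; congr (_ + _); apply: eq_bigr => i _.
    rewrite big_split_ord /= [X in _ + X]big1 ?addn0 => [|j _].
      by apply: eq_bigr => j _; rewrite block_mxEul.
    by rewrite block_mxEur mxE.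
  rewrite big_split_ord /= [X in X + _]big1 ?add0n => [|j _].
    by apply: eq_bigr => j _; rewrite block_mxEdr.
  by rewrite block_mxEdl mxE.
apply: nb_ones_le_ex; apply/negP => /containsP[f [g [fP gP ABQ]]].
have fge i : f ord0 <= f i.
  have [->//|] := eqVneq i ord0.
  by rewrite -val_eqE -lt0n => i_gt0; apply/ltnW/fP.
have gle j : g j <= g ord_max.
  have [->//|j_neq] := eqVneq j ord_max; apply/ltnW/gP.
  by rewrite /= ltn_neqAle leq_ord andbT -val_eqE in j_neq *.
have entry (x y : 'I_(a + b)) : AB x y ->
    (exists x' y', [/\ A x' y', x = x' :> nat & y = y' :> nat]) \/
    (exists x' y', [/\ B x' y', x = a + x' :> nat & y = a + y' :> nat]).
  case: (split_ordP x) => x' ->; case: (split_ordP y) => y' ->.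
  - by rewrite block_mxEul => Axy; left; exists x', y'.
  - by rewrite block_mxEur mxE.
  - by rewrite block_mxEdl mxE.
  - by rewrite block_mxEdr => Bxy; right; exists x', y'.
have [[_ [y [_ _ gy]]]|[x [_ [_ fx _]]]] := entry _ _ (ABQ _ _ corner).
  apply: (negP A_Q); apply: (@contains_permutation _ _ _ A Q
    (fun x i => x = f i :> nat) (fun y j => y = g j :> nat) permQ).
  - by move=> i i' x x' /fP lt_f -> ->.
  - by move=> j j' y1 y' /gP lt_g -> ->.
  move=> i j /ABQ/entry[[x' [y' [Axy -> ->]]]|[_ [y' [_ _ gj]]]]; first by exists x', y'.
  by have := gle j; rewrite gj gy leqNgt (leq_trans (ltn_ord y)) ?leq_addr.
apply: (negP B_Q); apply: (@contains_permutation _ _ _ B Q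
  (fun x i => a + x = f i :> nat) (fun y j => a + y = g j :> nat) permQ).
- by move=> i i' x1 x' /fP lt_f xi xi'; rewrite -(ltn_add2l a) xi xi'.
- by move=> j j' y y' /gP lt_g yj yj'; rewrite -(ltn_add2l a) yj yj'.
move=> i j /ABQ/entry[[x' [_ [_ fi _]]]|[x' [y' [Bxy -> ->]]]]; last by exists x', y'.
by have := fge i; rewrite fi fx leqNgt (leq_trans (ltn_ord x')) ?leq_addr.
Qed.

Lemma ex_superadditive k m a b (Q : 'M[bool]_m.+1) :
    permutation_matrix Q -> contains (Xmx k) Q ->
  ex a Q + ex b Q <= ex (a + b) Q.
Proof.
move=> permQ XQ; have rev0 : rev_ord (@ord0 m) = ord_max.
  by apply: val_inj; rewrite /= subn1.
have revm : rev_ord (@ord_max m) = ord0 by rewrite -rev0 rev_ordK.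
case/or4P: (corner_of_contained_X permQ XQ) => corner.
- rewrite -!(ex_flip _ Q); apply: ex_superadditive_top_right.
    exact: permutation_matrix_flip.
  by rewrite mxE revm.
- exact: ex_superadditive_top_right.
- rewrite -!(ex_tr _ Q); apply: ex_superadditive_top_right.
    exact: permutation_matrix_tr.
  by rewrite mxE.
rewrite -!(ex_flip _ Q) -!(ex_tr _ (flip Q)); apply: ex_superadditive_top_right.
  exact/permutation_matrix_tr/permutation_matrix_flip.
by rewrite !mxE rev0.
Qed.

(** * Explicit constants *)

(** Bernoulli's inequality (1 + 1/n)^j >= 1 + j/n, cleared of denominators. *)
Lemma bernoulli_nat n j : n ^ j * (n + j) <= n * n.+1 ^ j.
Proof.
elim: j => [|j IH]; first by rewrite !expn0; lia.
have -> : n * n.+1 ^ j.+1 = n.+1 * (n * n.+1 ^ j) by rewrite expnS mulnCA.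
apply: leq_trans (leq_mul (leqnn _) IH).
rewrite expnS -mulnA mulnCA [leqRHS]mulnCA leq_mul2l; apply/orP; right.
by lia.
Qed.

(** Bernoulli with j = n gives (1 + 1/n)^n >= 2, which is raised to the power [e]. *)
Lemma double_expn n e : 0 < n -> 2 ^ e * n ^ (n * e) <= n.+1 ^ (n * e).
Proof.
move=> n_gt0; rewrite !expnM -expnMn; case: e => // e; rewrite leq_exp2r //.
by rewrite -(leq_pmul2l n_gt0) mulnA muln2 -addnn mulnC bernoulli_nat.
Qed.

Lemma ex_le_two_exp k m n (Q : 'M[bool]_m) :
    permutation_matrix Q -> contains (Xmx k) Q -> ~~ odd k -> 2 <= k ->
  ex n Q <= 2 ^ (664 * trunc_log 2 k ^ 2) * n.
Proof.
move=> permQ XQ k_even k_ge2; set l := trunc_log 2 k.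
have k_gt0 : 0 < k by lia.
have k_lt : k < 2 ^ l.+1 := trunc_log_ltn k (isT : 1 < 2).
have l_gt0 : 0 < l by rewrite trunc_log_gt0 /=; lia.
(* [s] is a power of two between 4k and 8k, and [D] gives (32/31)^D >= 2^(l + 6) > 2^(l + 5) =
   4s. *)
pose D := 31 * (l + 6); pose s := 2 ^ (l + 3).
have s_ge : 4 * k <= s.
  by rewrite /s [l + 3](_ : _ = 2 + l.+1) ?[2 ^ _]expnD; lia.
have s_lt : 31 ^ D * (4 * s) < 32 ^ D.
  apply: leq_trans (double_expn (l + 6) (isT : 0 < 31)).
  rewrite -/D mulnC ltn_mul2r expn_gt0 /= -[4]/(2 ^ 2) -expnD.
  by rewrite ltn_exp2l //; lia.
apply: leq_trans (ex_linear n permQ XQ k_even k_gt0 s_ge s_lt) _.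
rewrite leq_mul2r; apply/orP; right.
apply: leq_trans (_ : 2 ^ 5 * (2 ^ (l + 2)) ^ D * (2 ^ (l + 3)) ^ 2 <= _).
  rewrite !leq_mul // leq_exp2r ?muln_gt0 //; last by lia.
  by rewrite [l + 2](_ : _ = 1 + l.+1) ?[2 ^ _]expnD; lia.
(* The exponent is 31 l^2 + 250 l + 383, at most 664 l^2 because l >= 1. *)
rewrite -!expnM -!expnD leq_exp2l // /D; nia.
Qed.

Local Open Scope ring_scope.
Local Open Scope classical_set_scope.

(** * Fekete's lemma and the limit *)

Lemma superadditive_mul (u : nat -> nat) q m :
  (forall a b, u a + u b <= u (a + b))%N -> (q * u m <= u (q * m))%N.
Proof.
move=> u_super; elim: q => // q IH; rewrite !mulSn.
by apply: leq_trans (u_super _ _); rewrite leq_add2l.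
Qed.

(** The limit is the supremum of the ratios: with q = n %/ m, superadditivity gives u n >= q u m,
    and (q + 1) m > n bounds the loss in the ratio by u m / n. *)
Lemma fekete (R : realType) (u : nat -> nat) B :
    (forall a b, u a + u b <= u (a + b))%N -> (forall n, u n <= B * n)%N ->
  cvgn (fun n => (u n)%:R / n%:R : R).
Proof.
move=> u_super u_le; pose v n : R := (u n)%:R / n%:R.
have v_ge0 n : 0 <= v n by rewrite divr_ge0 ?ler0n.
have v_leB n : v n <= B%:R.
  (* Division by zero yields 0, so [v 0] is 0. *)
  have [->|n_gt0] := posnP n; first by rewrite /v invr0 mulr0 ler0n.
  by rewrite ler_pdivrMr ?ltr0n // -natrM ler_nat.
have v_approx m n : (0 < n)%N -> v m - (u m)%:R / n%:R <= v n.
  move=> n_gt0; have [->|m_gt0] := posnP m.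
    by rewrite {1}/v invr0 mulr0 sub0r (le_trans _ (v_ge0 n)) // oppr_le0 divr_ge0 ?ler0n.
  rewrite lerBlDr -mulrDl ler_pdivrMr ?ltr0n // mulrAC ler_pdivlMr ?ltr0n //.
  rewrite -natrD -!natrM ler_nat.
  have u_n : (n %/ m * u m <= u n)%N.
    apply: leq_trans (superadditive_mul _ _ u_super) _.
    rewrite {2}(divn_eq n m); apply: leq_trans (u_super _ _); exact: leq_addr.
  have := ltn_ceil n m_gt0; nia.
pose E := range v.
have supE : has_sup E.
  by split; [exists (v 0%N), 0%N|exists B%:R => _ [n _ <-]].
apply/cvg_ex; exists (sup E); apply/cvgrPdist_lt => e e_gt0.
have e2_gt0 : 0 < e / 2 by rewrite divr_gt0.
have [_ [m _ <-] v_m] := sup_adherent e2_gt0 supE.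
near=> n.
have n_big : (u m)%:R * 2 / e < n%:R :> R by near: n; exact: nbhs_infty_gtr.
have n_gt0 : 0 < n%:R :> R.
  by apply: le_lt_trans n_big; rewrite divr_ge0 ?mulr_ge0 ?ler0n ?ltW.
have v_le : v n <= sup E by apply: sup_ubound; [case: supE|exists n].
rewrite ger0_norm ?subr_ge0 //.
have small : (u m)%:R / n%:R < e / 2.
  by move: n_big; rewrite !ltr_pdivrMr // => n_big; lra.
have := v_approx m n; rewrite -(ltr0n R) => /(_ n_gt0) => approx.
rewrite -/(v n); lra.
Unshelve. all: by end_near.
Qed.

Theorem theorem1p4 (R : realType) :
  exists C : R, 0 < C /\
    forall (k : nat) (hk2 : (2 <= k)%N) (hk : ~~ odd k)
           (m : nat) (Q : 'M[bool]_m)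
           (hQ : permutation_matrix Q) (hQX : contains (Xmx k) Q),
      cvgn (ex_ratio R Q) /\
      FH_limit R Q <= 2 `^ (C * (log2 (k%:R : R)) ^+ 2).
Proof.
exists 664; split=> // k k_ge2 k_even m Q permQ XQ.
set B := (2 ^ (664 * trunc_log 2 k ^ 2))%N.
have ex_le n : (ex n Q <= B * n)%N by exact: ex_le_two_exp.
have ratio_cvg : cvgn (ex_ratio R Q).
  (* The empty pattern has no corner, but every matrix contains it, so [ex] vanishes. *)
  case: m => [|m] in Q permQ XQ ex_le *.
    have ex0 n : ex n Q = 0%N.
      apply: big1 => A /negP[]; apply/containsP.
      by exists (widen_ord (leq0n n)), (widen_ord (leq0n n)); split=> -[].
    have -> : ex_ratio R Q = cst 0 by apply/funext => n; rewrite /ex_ratio ex0 mul0r.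
    exact: is_cvg_cst.
  by apply: fekete ex_le => a b; exact: ex_superadditive XQ.
split=> //; apply: (@le_trans _ _ B%:R).
  apply: limr_le => //; near=> n.
  rewrite /ex_ratio ler_pdivrMr ?ltr0n -?natrM ?ler_nat //.
  by near: n; exact: nbhs_infty_gt.
have l_le : (trunc_log 2 k)%:R <= log2 (k%:R : R).
  have ln2_gt0 : 0 < ln 2 :> R by rewrite ln_gt0 // ltr1n.
  rewrite /log2 ler_pdivlMr // mulr_natl -lnXn ?ltr0n //.
  rewrite ler_ln ?posrE ?exprn_gt0 ?ltr0n //; last by lia.
  by rewrite -natrX ler_nat trunc_logP //; lia.
rewrite /B natrX -(powR_mulrn _ (ler0n R 2)) ler_powR ?ler1n //.
rewrite natrM natrX ler_wpM2l ?ler0n // lerXn2r // ?nnegrE ?ler0n //.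
exact: le_trans l_le.
Unshelve. all: by end_near.
Qed.
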